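(* If one step of Jacobi's method is performed in floating point arithmetic in the $(p,q)$ plane on the symmetric matrix $A_k=(\hat a^{(k)}_{ij})\in\mathbb{R}^{n\times n}$ with the computed Jacobi rotation $\hat J_k=J(p,q;\hat c_k,\hat s_k)$, then the computed $A_{k+1}$ satisfies $$\|\mathrm{off}(A_{k+1})\|_F^2-\|\mathrm{off}(A_k)\|_F^2\le-2|\hat a^{(k)}_{pq}|^2+2\|H_k\|_F^2\tilde\gamma_4+2\|G_k\|_F^2\tilde\gamma_4^2.$$ Moreover, with $N=n(n-1)/2$, for arbitrarily chosen index pairs $\{(p_k,q_k)\}_{k=0}^{N-1}$ (the step from $A_k$ to $A_{k+1}$ being performed in the $(p_k,q_k)$ plane), we have $$2\sum_{k=0}^{N-1}|\hat a^{(k)}_{p_kq_k}|^2\le\|\mathrm{off}(A_0)\|_F^2+2\sum_{k=0}^{N-1}\|H_k\|_F^2\tilde\gamma_4+2\sum_{k=0}^{N-1}\|G_k\|_F^2\tilde\gamma_4^2.$$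
   Context: $\|\cdot\|_F$ is the Frobenius norm; $\mathrm{off}(G)=G-\mathrm{diag}(g_{11},\dots,g_{nn})$. Floating point model with unit roundoff $u$: $\mathrm{fl}(x\,\mathrm{op}\,y)=(x\,\mathrm{op}\,y)(1+\delta_1)=(x\,\mathrm{op}\,y)/(1+\delta_2)$, $|\delta_1|,|\delta_2|\le u$, $\mathrm{op}\in\{+,-,*,/\}$; $\mathrm{fl}(\sqrt x)=\sqrt x(1+\delta)$, $|\delta|\le u$. $\tilde\gamma_j:=(1-u)^{-wj}-1$, where $w>0$ is a fixed small integer constant (not depending on the matrix, its order, or $u$) whose exact value is unimportant. Jacobi rotation: for $p<q$ and $c^2+s^2=1$ (exact rotations), $J(p,q;c,s)$ is the identity matrix except that its $(p,p)$ and $(q,q)$ entries are $c$, its $(p,q)$ entry is $s$, its $(q,p)$ entry is $-s$; the same notation is used with computed $\hat c,\hat s$. The exact Jacobi rotation for a symmetric $A$ and the pair $(p,q)$ has $c=(1+t^2)^{-1/2}$, $s=tc$, with $t=1/(\mu+\sqrt{1+\mu^2})$ if $\mu\ge0$, $t=1/(\mu-\sqrt{1+\mu^2})$ if $\mu<0$, $\mu=(a_{qq}-a_{pp})/(2a_{pq})$, and $(c,s)=(1,0)$ if $a_{pq}=0$; it makes the $(p,q)$ entry of $J^TAJ$ zero. One floating point step in the $(p,q)$ plane on the symmetric matrix $A_k=(\hat a^{(k)}_{ij})$: $J_k=J(p,q;c_k,s_k)$ denotes the exact Jacobi rotation for $A_k$ and $(p,q)$, and $\hat J_k=J(p,q;\hat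 c_k,\hat s_k)$ the one computed in floating point, which satisfies $\hat c_k=c_k(1+\theta)$, $\hat s_k=s_k(1+\theta')$ with $|\theta|,|\theta'|\le\tilde\gamma_1$. The computed symmetric matrix $A_{k+1}$ agrees with $A_k$ outside rows and columns $p,q$, and (superscript $(k)$ and subscript $k$ dropped on the right) $\hat a^{(k+1)}_{pj}=\mathrm{fl}(\hat c\hat a_{pj}-\hat s\hat a_{qj})$, $\hat a^{(k+1)}_{qj}=\mathrm{fl}(\hat s\hat a_{pj}+\hat c\hat a_{qj})$ for $j\ne p,q$, $\hat a^{(k+1)}_{pp}=\mathrm{fl}(\hat c(\hat c\hat a_{pp}-\hat s\hat a_{pq})-\hat s(\hat c\hat a_{pq}-\hat s\hat a_{qq}))$, $\hat a^{(k+1)}_{pq}=\mathrm{fl}(\hat s(\hat c\hat a_{pp}-\hat s\hat a_{pq})+\hat c(\hat c\hat a_{pq}-\hat s\hat a_{qq}))$, and $\hat a^{(k+1)}_{qq}$ is computed analogously to $\hat a^{(k+1)}_{pp}$. $G_k$: symmetric $n\times n$ matrix, zero except that its entries at positions $(p,p),(p,q),(q,p),(q,q)$ equal those of $A_k$. $H_k$: symmetric $n\times n$ matrix, zero except that $(H_k)_{pj}=(H_k)_{jp}=\hat a^{(k)}_{pj}$ and $(H_k)_{qj}=(H_k)_{jq}=\hat a^{(k)}_{qj}$ for all $j\ne p,q$. Here $(p,q)$ is the pair used at step $k$. *)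

(* Defs.v *)
From mathcomp Require Import all_boot all_order all_algebra.
From mathcomp Require Import reals.

Set Implicit Arguments.
Unset Strict Implicit.
Unset Printing Implicit Defensive.

Import Order.TTheory GRing.Theory Num.Theory.
Local Open Scope ring_scope.

(* MathComp-Analysis norms matrices by the maximum of their entries, hence an
   explicit Frobenius norm. *)
Definition normF (R : realType) (m n : nat) (A : 'M[R]_(m, n)) : R :=
  Num.sqrt (\sum_i \sum_j `|A i j| ^+ 2).

Definition off (R : realType) (n : nat) (G : 'M[R]_n) : 'M[R]_n :=
  G - diag_mx (\row_i G i i).

Definition rounds_to (R : realType) (u x y : R) : Prop :=
  (exists2 d1 : R, `|d1| <= u & y = x * (1 + d1)) /\
  (exists2 d2 : R, `|d2| <= u & y = x / (1 + d2)).

(* The operations are total on the reals; a machine arithmetic defined only on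
   floating point numbers is covered by extending it with exact operations. *)
Record fparith (R : realType) (u : R) := FPArith {
  fladd : R -> R -> R;
  flsub : R -> R -> R;
  flmul : R -> R -> R;
  fldiv : R -> R -> R;
  flsqrt : R -> R;
  fladdP : forall x y, rounds_to u (x + y) (fladd x y);
  flsubP : forall x y, rounds_to u (x - y) (flsub x y);
  flmulP : forall x y, rounds_to u (x * y) (flmul x y);
  fldivP : forall x y, y != 0 -> rounds_to u (x / y) (fldiv x y);
  flsqrtP : forall x, 0 <= x ->
    exists2 d : R, `|d| <= u & flsqrt x = Num.sqrt x * (1 + d)
}.

Definition gammat (R : realType) (w : nat) (u : R) (j : nat) : R :=
  (1 - u) ^- (w * j) - 1.

Definition rotation (R : realType) (n : nat) (p q : 'I_n) (c s : R) : 'M[R]_n :=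
  \matrix_(i, j)
    if (i == p) && (j == p) then c
    else if (i == q) && (j == q) then c
    else if (i == p) && (j == q) then s
    else if (i == q) && (j == p) then - s
    else (i == j)%:R.

Definition jacobi_mu (R : realType) (n : nat) (A : 'M[R]_n) (p q : 'I_n) : R :=
  (A q q - A p p) / (2 * A p q).

Definition jacobi_t (R : realType) (mu : R) : R :=
  if 0 <= mu then 1 / (mu + Num.sqrt (1 + mu ^+ 2))
  else 1 / (mu - Num.sqrt (1 + mu ^+ 2)).

Definition jacobi_c (R : realType) (n : nat) (A : 'M[R]_n) (p q : 'I_n) : R :=
  if A p q == 0 then 1
  else (Num.sqrt (1 + jacobi_t (jacobi_mu A p q) ^+ 2))^-1.

Definition jacobi_s (R : realType) (n : nat) (A : 'M[R]_n) (p q : 'I_n) : R :=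
  if A p q == 0 then 0
  else jacobi_t (jacobi_mu A p q) * jacobi_c A p q.

Definition computed_rotation (R : realType) (w : nat) (u : R) (n : nat)
    (A : 'M[R]_n) (p q : 'I_n) (Jhat : 'M[R]_n) : Prop :=
  exists th th' : R,
    [/\ `|th| <= gammat w u 1, `|th'| <= gammat w u 1
      & Jhat = rotation p q (jacobi_c A p q * (1 + th))
                            (jacobi_s A p q * (1 + th'))].

(* The entries not listed are determined by the symmetry of A'. *)
Record fl_jacobi_update (R : realType) (u : R) (fl : fparith u) (n : nat)
    (p q : 'I_n) (c s : R) (A A' : 'M[R]_n) : Prop := FlJacobiUpdate {
  update_sym : A'^T = A';
  update_out : forall i j, i != p -> i != q -> j != p -> j != q ->
    A' i j = A i j;
  update_pj : forall j, j != p -> j != q ->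
    A' p j = flsub fl (flmul fl c (A p j)) (flmul fl s (A q j));
  update_qj : forall j, j != p -> j != q ->
    A' q j = fladd fl (flmul fl s (A p j)) (flmul fl c (A q j));
  update_pp : A' p p =
    flsub fl
      (flmul fl c (flsub fl (flmul fl c (A p p)) (flmul fl s (A p q))))
      (flmul fl s (flsub fl (flmul fl c (A p q)) (flmul fl s (A q q))));
  update_pq : A' p q =
    fladd fl
      (flmul fl s (flsub fl (flmul fl c (A p p)) (flmul fl s (A p q))))
      (flmul fl c (flsub fl (flmul fl c (A p q)) (flmul fl s (A q q))));
  update_qq : A' q q =
    fladd fl
      (flmul fl s (fladd fl (flmul fl s (A p p)) (flmul fl c (A p q))))
      (flmul fl c (fladd fl (flmul fl s (A p q)) (flmul fl c (A q q))))
}.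

(* The scalars chat and shat are read off Jhat = J(p, q; chat, shat). *)
Definition fl_jacobi_step (R : realType) (w : nat) (u : R) (fl : fparith u)
    (n : nat) (p q : 'I_n) (Jhat A A' : 'M[R]_n) : Prop :=
  computed_rotation w u A p q Jhat /\
  fl_jacobi_update fl p q (Jhat p p) (Jhat p q) A A'.

Definition Gpart (R : realType) (n : nat) (A : 'M[R]_n) (p q : 'I_n) :
    'M[R]_n :=
  \matrix_(i, j)
    if (i \in [:: p; q]) && (j \in [:: p; q]) then A i j else 0.

Definition Hpart (R : realType) (n : nat) (A : 'M[R]_n) (p q : 'I_n) :
    'M[R]_n :=
  \matrix_(i, j)
    if (i \in [:: p; q]) && (j \notin [:: p; q]) then A i j
    else if (i \notin [:: p; q]) && (j \in [:: p; q]) then A j i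
    else 0.

(* Main.v *)
Require Import Defs.
From mathcomp Require Import all_boot all_order all_algebra.
From mathcomp Require Import reals.
From mathcomp Require Import ring lra.

Set Implicit Arguments.
Unset Strict Implicit.
Unset Printing Implicit Defensive.

Import Order.TTheory GRing.Theory Num.Theory.
Local Open Scope ring_scope.

(** Write [a = (1 - u) ^- w], so that [gammat w u j = a ^+ j - 1], and take
    [w >= 2], so that two roundings together cost at most a factor [a].

    In exact arithmetic a Jacobi rotation preserves the Euclidean norm of every
    pair [(A p j, A q j)] with [j] outside the plane and annihilates the pivot,
    hence lowers the squared off-norm by exactly [2 * A p q ^+ 2].  It remains
    to see what rounding adds.

    Each computed entry is followed together with a majorant [m], the same
    expression evaluated on absolute values, and an amplification factor [k]:
    the error is at most [(k - 1) * m] (predicate [perturbed]).  Factors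
    multiply under products, are unchanged by sums with a common factor, and
    grow by [1 / (1 - u)] at each rounding.  One application of the computed
    rotation to a pair therefore costs the factor [a ^+ 2]: one [a] for the
    error in [c] and [s], one for the two roundings ([perturbed_fladd_comb],
    [perturbed_flsub_comb]).

    - The entries outside the [2 x 2] block are obtained by one application, so
      the square of each grows by at most [(a ^+ 4 - 1) * m ^+ 2], and the two
      squared majorants of a pair add up to at most twice its squared norm
      ([majorant_pair]).  This is the term
      [2 * normF (Hpart A p q) ^+ 2 * gammat w u 4].
    - The new pivot is obtained by two applications and its exact value is
      zero, so it is bounded by [(a ^+ 4 - 1) * m], where [m] is at most the
      Frobenius norm of the block ([majorant_pivot]).  This is the
      term [2 * normF (Gpart A p q) ^+ 2 * gammat w u 4 ^+ 2].

    The sum over several steps telescopes, the final squared off-norm being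
    nonnegative. *)

(** * Running error analysis *)

(** [y] approximates [x] with amplification factor [k] relative to a majorant
    [m] of [x]; the majorant is carried along because the error of a difference
    is not controlled by the difference itself. *)
Definition perturbed (R : realType) (k m x y : R) : Prop :=
  `|x| <= m /\ `|y - x| <= (k - 1) * m.

Lemma perturbed_exact (R : realType) (x : R) : perturbed 1 `|x| x x.
Proof. by split=> //; rewrite !subrr normr0 mul0r. Qed.

Lemma perturbed_le (R : realType) (k k' m x y : R) :
  k <= k' -> perturbed k m x y -> perturbed k' m x y.
Proof.
move=> kk' [xm yx]; split=> //; apply: le_trans yx _.
by rewrite ler_wpM2r ?lerD2r// (le_trans _ xm).
Qed.

Lemma perturbed_relative (R : realType) (k x th : R) :
  `|th| <= k - 1 -> perturbed k `|x| x (x * (1 + th)).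
Proof.
move=> hth; split=> //.
by rewrite mulrDr mulr1 addrAC subrr add0r normrM mulrC ler_wpM2r.
Qed.

(** From [y1 * y2 - x1 * x2 = y1 * (y2 - x2) + (y1 - x1) * x2] and
    [`|y1| <= k1 * m1]. *)
Lemma perturbedM (R : realType) (k1 k2 m1 m2 x1 x2 y1 y2 : R) :
  perturbed k1 m1 x1 y1 -> perturbed k2 m2 x2 y2 ->
  perturbed (k1 * k2) (m1 * m2) (x1 * x2) (y1 * y2).
Proof.
move=> [xm1 yx1] [xm2 yx2]; split; first by rewrite normrM ler_pM.
have y1m : `|y1| <= k1 * m1.
  rewrite -[y1](subrK x1); apply: le_trans (ler_normD _ _) _; lra.
have -> : y1 * y2 - x1 * x2 = y1 * (y2 - x2) + (y1 - x1) * x2 by ring.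
have -> : (k1 * k2 - 1) * (m1 * m2) =
    k1 * m1 * ((k2 - 1) * m2) + (k1 - 1) * m1 * m2 by ring.
by apply: le_trans (ler_normD _ _) _; rewrite !normrM lerD// ler_pM.
Qed.

Lemma perturbedD (R : realType) (k m1 m2 x1 x2 y1 y2 : R) :
  perturbed k m1 x1 y1 -> perturbed k m2 x2 y2 ->
  perturbed k (m1 + m2) (x1 + x2) (y1 + y2).
Proof.
move=> [xm1 yx1] [xm2 yx2]; split.
  by apply: le_trans (ler_normD _ _) _; rewrite lerD.
by rewrite opprD addrACA mulrDr (le_trans (ler_normD _ _))// lerD.
Qed.

Lemma perturbedN (R : realType) (k m x y : R) :
  perturbed k m x y -> perturbed k m (- x) (- y).
Proof. by move=> [xm yx]; split; rewrite ?normrN// -opprD normrN. Qed.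

Lemma perturbed_round (R : realType) (u k m x y z : R) :
  u < 1 -> perturbed k m x y -> rounds_to u y z ->
  perturbed (k * (1 - u)^-1) m x z.
Proof.
move=> u1 pxy [[d du ->] _].
have u0 : 0 <= u by apply: le_trans du.
have dle : `|d| <= (1 - u)^-1 - 1.
  have -> : (1 - u)^-1 - 1 = u / (1 - u) by field; lra.
  by apply: le_trans du _; rewrite ler_pdivlMr; [nra|lra].
have := perturbedM pxy (perturbed_relative 1 dle).
by rewrite normr1 !mulr1 mul1r.
Qed.

Lemma perturbed_flmul (R : realType) (u : R) (fl : fparith u)
    (a k c ch mx x xh : R) :
  u < 1 -> perturbed a `|c| c ch -> perturbed k mx x xh ->
  perturbed (a * k * (1 - u)^-1) (`|c| * mx) (c * x) (flmul fl ch xh).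
Proof.
by move=> u1 pc px; apply: (perturbed_round u1 (perturbedM pc px)); apply: flmulP.
Qed.

(** The rounding of a product and that of the sum it enters share one factor
    [a]; the other factor [a] is the error of the coefficient. *)
Lemma two_roundings_le (R : realType) (u a k : R) :
  (1 - u)^-1 ^+ 2 <= a -> 0 <= k ->
  a * k * (1 - u)^-1 * (1 - u)^-1 <= a ^+ 2 * k.
Proof.
move=> ua k0; have a0 : 0 <= a by apply: le_trans ua; rewrite sqr_ge0.
have -> : a ^+ 2 * k = a * k * a by ring.
by rewrite -mulrA -expr2 ler_wpM2l ?mulr_ge0.
Qed.

(** One row of the computed rotation applied to a perturbed pair.  As the majorant
    has the same shape as the exact value, the lemma can be iterated. *)
Lemma perturbed_fladd_comb (R : realType) (u : R) (fl : fparith u)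
    (a k c s ch sh mx my x y xh yh : R) :
  u < 1 -> (1 - u)^-1 ^+ 2 <= a -> 0 <= k ->
  perturbed a `|c| c ch -> perturbed a `|s| s sh ->
  perturbed k mx x xh -> perturbed k my y yh ->
  perturbed (a ^+ 2 * k) (`|c| * mx + `|s| * my) (c * x + s * y)
    (fladd fl (flmul fl ch xh) (flmul fl sh yh)).
Proof.
move=> u1 ua k0 pc ps px py; apply: (perturbed_le (two_roundings_le ua k0)).
apply: (perturbed_round u1 _ (fladdP _ _ _)).
by apply: perturbedD; apply: perturbed_flmul.
Qed.

Lemma perturbed_flsub_comb (R : realType) (u : R) (fl : fparith u)
    (a k c s ch sh mx my x y xh yh : R) :
  u < 1 -> (1 - u)^-1 ^+ 2 <= a -> 0 <= k ->
  perturbed a `|c| c ch -> perturbed a `|s| s sh ->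
  perturbed k mx x xh -> perturbed k my y yh ->
  perturbed (a ^+ 2 * k) (`|c| * mx + `|s| * my) (c * x - s * y)
    (flsub fl (flmul fl ch xh) (flmul fl sh yh)).
Proof.
move=> u1 ua k0 pc ps px py; apply: (perturbed_le (two_roundings_le ua k0)).
apply: (perturbed_round u1 _ (flsubP _ _ _)).
by apply: perturbedD; last apply: perturbedN; apply: perturbed_flmul.
Qed.

(** With [e = k - 1], [y ^+ 2 - x ^+ 2 <= 2 * e * m ^+ 2 + e ^+ 2 * m ^+ 2]. *)
Lemma perturbed_sqr (R : realType) (k m x y : R) :
  perturbed k m x y -> y ^+ 2 - x ^+ 2 <= (k ^+ 2 - 1) * m ^+ 2.
Proof.
move=> [xm yx].
have -> : y ^+ 2 - x ^+ 2 = (y - x) ^+ 2 + 2 * ((y - x) * x) by ring.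
have -> : (k ^+ 2 - 1) * m ^+ 2 =
  ((k - 1) * m) ^+ 2 + 2 * ((k - 1) * m * m) by ring.
rewrite lerD// ?ler_wpM2l//.
  by rewrite -[leLHS]real_normK ?num_real// lerXn2r ?nnegrE ?(le_trans _ yx).
by apply: le_trans (ler_norm _) _; rewrite normrM ler_pM.
Qed.

(** * The exact rotation *)

(** Each case is the conjugate form [Num.sqrt (1 + mu ^+ 2) - mu], respectively
    [- Num.sqrt (1 + mu ^+ 2) - mu], of a root of the quadratic. *)
Lemma jacobi_t_root (R : realType) (mu : R) :
  jacobi_t mu ^+ 2 + 2 * mu * jacobi_t mu = 1.
Proof.
rewrite /jacobi_t; set r := Num.sqrt _.
have r2 : r ^+ 2 = 1 + mu ^+ 2 by rewrite sqr_sqrtr// addr_ge0// sqr_ge0.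
have r0 : 0 < r by rewrite sqrtr_gt0 ltr_pwDl// sqr_ge0.
case: ifP => [mu0|/negbT]; last rewrite -ltNge => mu0.
  suff -> : 1 / (mu + r) = r - mu by lra.
  have nz : mu + r != 0 by lra.
  by apply: (mulIf nz); rewrite divfK//; lra.
suff -> : 1 / (mu - r) = - r - mu by lra.
have nz : mu - r != 0 by lra.
by apply: (mulIf nz); rewrite divfK//; lra.
Qed.

Lemma jacobi_cs1 (R : realType) (n : nat) (A : 'M[R]_n) (p q : 'I_n) :
  jacobi_c A p q ^+ 2 + jacobi_s A p q ^+ 2 = 1.
Proof.
rewrite /jacobi_s /jacobi_c; case: ifP => _; first by rewrite expr1n expr0n addr0.
set t := jacobi_t _; have t0 : 0 < 1 + t ^+ 2 by rewrite ltr_pwDl// sqr_ge0.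
rewrite exprMn exprVn sqr_sqrtr ?ltW//; field.
by rewrite gt_eqF.
Qed.

(** The left-hand side is the [(p, q)] entry of [J^T *m A *m J]. *)
Lemma jacobi_annihilates (R : realType) (n : nat) (A : 'M[R]_n) (p q : 'I_n)
    (c := jacobi_c A p q) (s := jacobi_s A p q) :
  s * (c * A p p - s * A p q) + c * (c * A p q - s * A q q) = 0.
Proof.
rewrite /s /jacobi_s; case: eqP => [->|/eqP nz].
  by rewrite !(mul0r, mulr0, subr0, addr0).
have := jacobi_t_root (jacobi_mu A p q); rewrite -/c.
set t := jacobi_t _ => tE.
have muE : 2 * jacobi_mu A p q * A p q = A q q - A p p.
  by rewrite /jacobi_mu; field.
have -> : t * c * (c * A p p - t * c * A p q) +
          c * (c * A p q - t * c * A q q) =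
  c ^+ 2 * ((1 - t ^+ 2) * A p q - t * (A q q - A p p)) by ring.
rewrite -muE -{1}tE; ring.
Qed.

(** * Bounds on the majorants *)

(** [(`|c|, `|s|)] is a unit vector, so the mixed product [4 * `|c s x y|] is at
    most [x ^+ 2 + y ^+ 2]. *)
Lemma majorant_pair (R : realType) (c s x y : R) : c ^+ 2 + s ^+ 2 = 1 ->
  (`|c| * `|x| + `|s| * `|y|) ^+ 2 + (`|s| * `|x| + `|c| * `|y|) ^+ 2
    <= 2 * (x ^+ 2 + y ^+ 2).
Proof.
have nK (z : R) : `|z| ^+ 2 = z ^+ 2 by rewrite real_normK ?num_real.
rewrite -(nK c) -(nK s) -(nK x) -(nK y).
move: (normr_ge0 c) (normr_ge0 s) (normr_ge0 x) (normr_ge0 y).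
move: `|c| `|s| `|x| `|y| => {}c {}s {}x {}y c0 s0 x0 y0 cs.
have cs1 : 2 * (c * s) <= 1 by have := sqr_ge0 (c - s); lra.
have xy : 2 * (x * y) <= x ^+ 2 + y ^+ 2 by have := sqr_ge0 (x - y); lra.
have mixed : 2 * (c * s) * (2 * (x * y)) <= x ^+ 2 + y ^+ 2.
  by apply: le_trans xy; rewrite ler_piMl// !mulr_ge0.
have : (c ^+ 2 + s ^+ 2) * (x ^+ 2 + y ^+ 2) = x ^+ 2 + y ^+ 2.
  by rewrite cs mul1r.
lra.
Qed.

(** Cauchy's inequality: the majorant is [`|c s| * (`|x| + `|z|) + `|y|], and
    [`|c s| <= 1 / 2]. *)
Lemma majorant_pivot (R : realType) (c s x y z : R) : c ^+ 2 + s ^+ 2 = 1 ->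
  (`|s| * (`|c| * `|x| + `|s| * `|y|) + `|c| * (`|c| * `|y| + `|s| * `|z|)) ^+ 2
    <= x ^+ 2 + 2 * y ^+ 2 + z ^+ 2.
Proof.
have nK (w : R) : `|w| ^+ 2 = w ^+ 2 by rewrite real_normK ?num_real.
rewrite -(nK c) -(nK s) -(nK x) -(nK y) -(nK z).
move: (normr_ge0 c) (normr_ge0 s) (normr_ge0 x) (normr_ge0 y) (normr_ge0 z).
move: `|c| `|s| `|x| `|y| `|z| => {}c {}s {}x {}y {}z c0 s0 x0 y0 z0 cs.
have cs1 : 2 * (c * s) <= 1 by have := sqr_ge0 (c - s); lra.
have -> : s * (c * x + s * y) + c * (c * y + s * z) = c * s * (x + z) + y.
  by rewrite -[y in RHS]mul1r -cs; ring.
have le2 : c * s * (x + z) + y <= (x + z) / 2 + y.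
  by rewrite lerD2r mulrC ler_wpM2l ?addr_ge0//; lra.
apply: (@le_trans _ _ (((x + z) / 2 + y) ^+ 2)).
  have l0 : 0 <= c * s * (x + z) + y by rewrite !(addr_ge0, mulr_ge0).
  by rewrite lerXn2r// nnegrE (le_trans l0).
have := sqr_ge0 (x - z); have := sqr_ge0 (x + z - 2 * y); lra.
Qed.

(** * Frobenius norms split along the plane *)

Lemma sqr_normF (R : realType) (m n : nat) (A : 'M[R]_(m, n)) :
  normF A ^+ 2 = \sum_i \sum_j A i j ^+ 2.
Proof.
rewrite sqr_sqrtr; last by do 2!(apply: sumr_ge0 => ? _); rewrite exprn_ge0.
by do 2!(apply: eq_bigr => ? _); rewrite real_normK ?num_real.
Qed.

Lemma offE (R : realType) (n : nat) (A : 'M[R]_n) (i j : 'I_n) :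
  off A i j = if i == j then 0 else A i j.
Proof.
rewrite !mxE; case: eqP => [->|_]; first by rewrite mulr1n subrr.
by rewrite mulr0n subr0.
Qed.

Lemma big_plane (R : realType) (n : nat) (p q : 'I_n) (F : 'I_n -> R) :
  p != q ->
  \sum_i F i = F p + F q + \sum_(i | (i != p) && (i != q)) F i.
Proof.
move=> pq; rewrite (bigD1 p)//= (bigD1 q) /=; last by rewrite eq_sym.
by rewrite addrA.
Qed.

Lemma sqr_normF_plane (R : realType) (n : nat) (p q : 'I_n) (A : 'M[R]_n) :
  p != q -> (forall i j, A i j = A j i) ->
  normF A ^+ 2 = A p p ^+ 2 + 2 * A p q ^+ 2 + A q q ^+ 2
    + 2 * (\sum_(j | (j != p) && (j != q)) (A p j ^+ 2 + A q j ^+ 2))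
    + \sum_(i | (i != p) && (i != q)) \sum_(j | (j != p) && (j != q)) A i j ^+ 2.
Proof.
move=> pq symA; rewrite sqr_normF (big_plane _ pq).
rewrite !(big_plane (fun j => A _ j ^+ 2) pq).
under [X in _ + X]eq_bigr => i _ do
  rewrite (big_plane _ pq) (symA i p) (symA i q).
by rewrite !big_split /= (symA q p); ring.
Qed.

Lemma sym_entries (R : realType) (n : nat) (A : 'M[R]_n) :
  A^T = A -> forall i j, A i j = A j i.
Proof. by move=> symA i j; rewrite -{1}symA mxE. Qed.

Lemma sqr_normF_Gpart (R : realType) (n : nat) (p q : 'I_n) (A : 'M[R]_n) :
  p != q -> A^T = A ->
  normF (Gpart A p q) ^+ 2 = A p p ^+ 2 + 2 * A p q ^+ 2 + A q q ^+ 2.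
Proof.
move=> pq /sym_entries symA; rewrite (sqr_normF_plane pq); last first.
  by move=> i j; rewrite !mxE andbC symA.
rewrite !mxE !inE !eqxx !orbT /=.
rewrite big1 => [|j /andP[/negbTE jp /negbTE jq]]; last first.
  by rewrite !mxE !inE jp jq !andbF expr0n addr0.
rewrite big1 => [|i /andP[/negbTE ip /negbTE iq]]; last first.
  by rewrite big1// => j _; rewrite !mxE !inE ip iq expr0n.
by rewrite mulr0 !addr0.
Qed.

Lemma sqr_normF_Hpart (R : realType) (n : nat) (p q : 'I_n) (A : 'M[R]_n) :
  p != q ->
  normF (Hpart A p q) ^+ 2 =
    2 * (\sum_(j | (j != p) && (j != q)) (A p j ^+ 2 + A q j ^+ 2)).
Proof.
move=> pq; rewrite (sqr_normF_plane pq); last first.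
  move=> i j; rewrite !mxE.
  by case: (i \in _); case: (j \in _).
rewrite !mxE !inE !eqxx !orbT /=.
rewrite [X in _ + X]big1 => [|i /andP[/negbTE ip /negbTE iq]]; last first.
  rewrite big1// => j /andP[/negbTE jp /negbTE jq].
  by rewrite !mxE !inE ip iq jp jq /= expr0n.
rewrite expr0n mulr0 !addr0 add0r; congr (2 * _).
apply: eq_bigr => j /andP[/negbTE jp /negbTE jq].
by rewrite !mxE !inE jp jq !eqxx !orbT.
Qed.

Lemma sqr_normF_off (R : realType) (n : nat) (p q : 'I_n) (A : 'M[R]_n) :
  p != q -> A^T = A ->
  normF (off A) ^+ 2 = 2 * A p q ^+ 2
    + 2 * (\sum_(j | (j != p) && (j != q)) (A p j ^+ 2 + A q j ^+ 2))
    + \sum_(i | (i != p) && (i != q)) \sum_(j | (j != p) && (j != q))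
        off A i j ^+ 2.
Proof.
move=> pq /sym_entries symA; rewrite (sqr_normF_plane pq); last first.
  by move=> i j; rewrite !offE eq_sym symA.
rewrite !offE !eqxx (negbTE pq) expr0n add0r addr0; congr (_ + 2 * _ + _).
apply: eq_bigr => j /andP[jp jq].
by rewrite !offE ![_ == j]eq_sym (negbTE jp) (negbTE jq).
Qed.

(** * One step *)

Lemma rotation_pp (R : realType) (n : nat) (p q : 'I_n) (c s : R) :
  rotation p q c s p p = c.
Proof. by rewrite mxE eqxx. Qed.

Lemma rotation_pq (R : realType) (n : nat) (p q : 'I_n) (c s : R) :
  p != q -> rotation p q c s p q = s.
Proof. by move=> pq; rewrite mxE (eq_sym q) !eqxx (negbTE pq). Qed.

Lemma gammatE (R : realType) (w : nat) (u : R) (j : nat) :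
  gammat w u j = ((1 - u) ^- w) ^+ j - 1.
Proof. by rewrite /gammat exprM exprVn. Qed.

Lemma invr_expn2_le (R : realType) (u : R) (w : nat) : 0 < u -> u < 1 ->
  (2 <= w)%N -> (1 - u)^-1 ^+ 2 <= (1 - u) ^- w.
Proof.
move=> u0 u1 w2; rewrite -exprVn ler_weXn2l// invf_ge1; lra.
Qed.

Lemma jacobi_step_off (R : realType) (w : nat) (u : R) (fl : fparith u)
    (n : nat) (p q : 'I_n) (Jhat A A' : 'M[R]_n) :
  (2 <= w)%N -> 0 < u -> u < 1 -> p != q -> A^T = A ->
  fl_jacobi_step w fl p q Jhat A A' ->
  normF (off A') ^+ 2 - normF (off A) ^+ 2 <=
    - (2 * `|A p q| ^+ 2)
    + 2 * normF (Hpart A p q) ^+ 2 * gammat w u 4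
    + 2 * normF (Gpart A p q) ^+ 2 * gammat w u 4 ^+ 2.
Proof.
move=> w2 u0 u1 pq symA [[th [th' [hth hth' ->]]]].
rewrite rotation_pp rotation_pq//.
have cs1 := jacobi_cs1 A p q; have pivot := jacobi_annihilates A p q.
move: hth hth'; rewrite !gammatE expr1.
have ua := invr_expn2_le u0 u1 w2.
move: ((1 - u) ^- w) ua => a ua.
move: (jacobi_c A p q) (jacobi_s A p q) cs1 pivot => c s cs1 pivot.
move=> /(perturbed_relative c) pc /(perturbed_relative s) ps.
move: (c * _) (s * _) pc ps => ch sh pc ps [symA' out upj uqj _ upq _].
have ea : a ^+ 2 * a ^+ 2 = a ^+ 4 by rewrite -exprD.
have outer j : (j != p) && (j != q) ->
    A' p j ^+ 2 + A' q j ^+ 2 <=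
    (1 + 2 * (a ^+ 4 - 1)) * (A p j ^+ 2 + A q j ^+ 2).
  case/andP=> jp jq; rewrite upj// uqj//.
  have pp := perturbed_exact (A p j); have pqj := perturbed_exact (A q j).
  have := perturbed_sqr (perturbed_flsub_comb fl u1 ua ler01 pc ps pp pqj).
  have := perturbed_sqr (perturbed_fladd_comb fl u1 ua ler01 ps pc pp pqj).
  have b1 : 1 <= (1 - u)^-1 by rewrite invf_ge1; lra.
  have a1 : 1 <= a by apply: le_trans ua; rewrite exprn_ege1.
  have a4 : 0 <= a ^+ 4 - 1 by rewrite subr_ge0 exprn_ege1.
  rewrite !mulr1 -!exprM.
  have := ler_wpM2l a4 (majorant_pair (A p j) (A q j) cs1).
  have : (c ^+ 2 + s ^+ 2) * (A p j ^+ 2 + A q j ^+ 2) = A p j ^+ 2 + A q j ^+ 2.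
    by rewrite cs1 mul1r.
  lra.
have inner : A' p q ^+ 2 <=
    (a ^+ 4 - 1) ^+ 2 * (A p p ^+ 2 + 2 * A p q ^+ 2 + A q q ^+ 2).
  rewrite upq.
  have exact := perturbed_exact.
  have top := perturbed_flsub_comb fl u1 ua ler01 pc ps
    (exact _ (A p p)) (exact _ (A p q)).
  have bot := perturbed_flsub_comb fl u1 ua ler01 pc ps
    (exact _ (A p q)) (exact _ (A q q)).
  have k0 : 0 <= a ^+ 2 * 1 by rewrite mulr1 sqr_ge0.
  have [_] := perturbed_fladd_comb fl u1 ua k0 ps pc top bot.
  rewrite pivot subr0 mulr1 ea => err.
  have := ler_pM (normr_ge0 _) (normr_ge0 _) err err.
  rewrite -!expr2 exprMn real_normK ?num_real// => /le_trans; apply.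
  by rewrite ler_wpM2l ?sqr_ge0// majorant_pivot.
rewrite (sqr_normF_off pq symA) (sqr_normF_off pq symA').
rewrite (sqr_normF_Gpart pq symA) (sqr_normF_Hpart _ pq).
have := ler_sum (index_enum 'I_n) outer; rewrite -mulr_sumr.
have -> : \sum_(i | (i != p) && (i != q))
            \sum_(j | (j != p) && (j != q)) off A' i j ^+ 2
        = \sum_(i | (i != p) && (i != q))
            \sum_(j | (j != p) && (j != q)) off A i j ^+ 2.
  apply: eq_bigr => i /andP[ip iq]; apply: eq_bigr => j /andP[jp jq].
  by rewrite !offE out.
rewrite real_normK ?num_real//.
move: inner; lra.
Qed.

Theorem lemma3p6 (R : realType) :
  exists w0 : nat, (0 < w0)%N /\
  forall (w : nat), (w0 <= w)%N ->
  forall (u : R) (fl : fparith u), 0 < u -> u < 1 ->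
  forall n : nat,
    (forall (p q : 'I_n) (Jhat A A' : 'M[R]_n),
       (p < q)%N -> A^T = A ->
       fl_jacobi_step w fl p q Jhat A A' ->
       normF (off A') ^+ 2 - normF (off A) ^+ 2 <=
         - (2 * `|A p q| ^+ 2)
         + 2 * normF (Hpart A p q) ^+ 2 * gammat w u 4
         + 2 * normF (Gpart A p q) ^+ 2 * gammat w u 4 ^+ 2)
    /\
    (let N := ((n * (n - 1)) %/ 2)%N in
     forall (p q : nat -> 'I_n) (Jhat A : nat -> 'M[R]_n),
       (A 0%N)^T = A 0%N ->
       (forall k : nat, (k < N)%N ->
          (p k < q k)%N /\
          fl_jacobi_step w fl (p k) (q k) (Jhat k) (A k) (A k.+1)) ->
       2 * (\sum_(0 <= k < N) `|A k (p k) (q k)| ^+ 2) <=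
         normF (off (A 0%N)) ^+ 2
         + 2 * (\sum_(0 <= k < N)
                  normF (Hpart (A k) (p k) (q k)) ^+ 2 * gammat w u 4)
         + 2 * (\sum_(0 <= k < N)
                  normF (Gpart (A k) (p k) (q k)) ^+ 2 * gammat w u 4 ^+ 2)).
Proof.
exists 2%N; split=> // w w2 u fl u0 u1 n.
have step (p q : 'I_n) (Jhat A A' : 'M[R]_n) : (p < q)%N -> A^T = A ->
    fl_jacobi_step w fl p q Jhat A A' ->
    normF (off A') ^+ 2 - normF (off A) ^+ 2 <=
    - (2 * `|A p q| ^+ 2) + 2 * normF (Hpart A p q) ^+ 2 * gammat w u 4
    + 2 * normF (Gpart A p q) ^+ 2 * gammat w u 4 ^+ 2.
  by move=> pq; apply: jacobi_step_off => //; rewrite -val_eqE neq_ltn pq.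
split=> // N p q Jhat A symA steps.
have symAk k : (k < N)%N -> (A k)^T = A k.
  by case: k => [//|k] /ltnW/steps[_ [_ /update_sym]].
(* the squared off-norm of [A M] is kept on the left, so that the induction step
   is one application of [step] *)
suff tele M : (M <= N)%N ->
    normF (off (A M)) ^+ 2 + 2 * (\sum_(0 <= k < M) `|A k (p k) (q k)| ^+ 2) <=
    normF (off (A 0%N)) ^+ 2
    + 2 * (\sum_(0 <= k < M)
             normF (Hpart (A k) (p k) (q k)) ^+ 2 * gammat w u 4)
    + 2 * (\sum_(0 <= k < M)
             normF (Gpart (A k) (p k) (q k)) ^+ 2 * gammat w u 4 ^+ 2).
  by have := tele N (leqnn N); have := sqr_ge0 (normF (off (A N))); lra.
elim: M => [_|M IH MN]; first by rewrite !big_nil; lra.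
have [pq /(step _ _ _ _ _ pq (symAk _ MN))] := steps M MN.
rewrite !big_nat_recr//=; have := IH (ltnW MN); lra.
Qed.
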